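(* Let $X,Y$ be infinite-dimensional Banach spaces that are uniformly convex and uniformly smooth, let $T\in K(X,Y)$ have trivial kernel, and let $T=B\circ A$ where $H$ is a Hilbert space, $A\in K(X,H)$, $B\in K(H,Y)$, and $A$ and $B$ have trivial kernels and ranges dense in their target spaces. Let $\{h_i^{A^*}\},\{x_i^{A^*}\},\{\lambda_i^{A^*}\}$ be the sequences associated with $A^*\in K(H,X^* )$, and $\{h_j^B\},\{y_j^B\},\{\lambda_j^B\}$ those associated with $B\in K(H,Y)$, by the $j$-eigenvector procedure. Then $$T(x)=BA(x)=\sum_{j=1}^{\infty}\sum_{i=1}^{\infty}\lambda_j^B\,\lambda_i^{A^*}\,y_j^B\,\langle x,x_i^{A^*}\rangle_X\,\langle h_i^{A^*},h_j^B\rangle_H\qquad(x\in X).$$ If $\{\lambda_i^{A^*}\}$ and $\{\lambda_i^{B}\}$ belong to $l_2$, the terms may be rearranged as we please.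
   Context: Spaces are real. $K(\cdot,\cdot)$ denotes compact linear maps; $\langle x,x^*\rangle_X$ is the value of $x^*\in X^*$ at $x\in X$, and $\langle\cdot,\cdot\rangle_H$ is the inner product of $H$. The adjoint $A^*$ is regarded as a map from $H$ (identified with its dual) to $X^*$. The $j$-eigenvector procedure for $S\in K(H,Z)$, where $H$ is a Hilbert space and $Z$ is uniformly convex and uniformly smooth. Put $H_1=H$ and choose $h_1^S\in H$ with $\|h_1^S\|_H=1$, $\|Sh_1^S\|_Z=\|S\|=:\lambda_1^S$. Given $h_1^S,\dots,h_{k-1}^S$, put $H_k=\{h\in H:\langle h,h_i^S\rangle_H=0,\ i<k\}$; if $S|_{H_k}\ne0$, choose $h_k^S\in H_k$ with $\|h_k^S\|_H=1$ and $\|Sh_k^S\|_Z=\lambda_k^S:=\|S|_{H_k}\|$. The $h_k^S$ and $\lambda_k^S$ are the $j$-eigenvectors and $j$-eigenvalues of $S$. For $S=B$, $Z=Y$ put $y_k^B=Bh_k^B/\lambda_k^B\in Y$; for $S=A^*$, $Z=X^*$ put $x_k^{A^*}=A^*h_k^{A^*}/\lambda_k^{A^*}\in X^*$. *)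

(* Defs.v *)
From HB Require Import structures.
From mathcomp Require Import all_boot all_order all_algebra.
From mathcomp Require Import finmap sesquilinear.
From mathcomp Require Import boolp classical_sets functions cardinality reals.
From mathcomp Require Import topology normedtype sequences.
From mathcomp Require Import ring lra.
From mathcomp.analysis.showcase Require summability.

Set Implicit Arguments.
Unset Strict Implicit.
Unset Printing Implicit Defensive.

Import Order.TTheory GRing.Theory Num.Theory.
Import numFieldNormedType.Exports.

Local Open Scope classical_set_scope.
Local Open Scope ring_scope.

Section Geometry.
Variables (R : realType) (V : normedModType R).

Definition finite_dimensional :=
  exists (n : nat) (v : 'I_n -> V), forall x : V,
    exists a : 'I_n -> R, x = \sum_(i < n) a i *: v i.

Definition infinite_dimensional := ~ finite_dimensional.

Definition uniformly_convex :=
  forall eps : R, 0 < eps -> exists2 delta : R, 0 < delta &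
    forall x y : V, `|x| = 1 -> `|y| = 1 -> eps <= `|x - y| ->
      `|2^-1 *: (x + y)| <= 1 - delta.

(* The modulus of smoothness rho satisfies rho(t) / t --> 0 as t --> 0+. *)
Definition uniformly_smooth :=
  forall eps : R, 0 < eps -> exists2 delta : R, 0 < delta &
    forall x y : V, `|x| = 1 -> `|y| <= delta ->
      (`|x + y| + `|x - y|) / 2 - 1 <= eps * `|y|.

End Geometry.

Section Operators.
Variables (R : realType) (V W : normedModType R).

(* Meaningful when D is a linear subspace of V and f is linear and bounded. *)
Definition opnorm_on (D : set V) (f : V -> W) : R :=
  sup [set `|f x| | x in D `&` [set x | `|x| <= 1]].

Definition compact_operator (f : V -> W) :=
  precompact (f @` [set x | `|x| <= 1]).

Definition trivial_kernel (f : V -> W) := forall x, f x = 0 -> x = 0.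

Lemma compact_operator_continuous (f : {linear V -> W}) :
  compact_operator f -> continuous f.
Proof.
rewrite /compact_operator precompactE => /compact_bounded[M [Mreal fM]].
apply/linear_bounded_continuous/ex_bound; exists (`|M| + 1).
apply/nbhs_normP; exists 1 => //= x; rewrite /= sub0r normrN => x1.
apply: fM; first by rewrite (le_lt_trans (ler_norm M))// ltrDl.
by apply: subset_closure; exists x => //=; exact: ltW.
Qed.

End Operators.

Section Dual.
Variables (R : realType) (X : normedModType R).

Definition continuous_functional : {pred X -> R^o} :=
  fun f => `[< linear f /\ continuous f >].

Record dual := Dual {
  dual_fun :> X -> R^o ;
  _ : dual_fun \in continuous_functional }.

HB.instance Definition _ := [isSub for dual_fun].
HB.instance Definition _ := [Choice of dual by <:].

Lemma continuous_functional_submod : submod_closed continuous_functional.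
Proof.
split.
  apply/asboolP; split; last by move=> x; exact: cvg_cst.
  by move=> a x y; rewrite /= scaler0 addr0.
move=> a f g /asboolP[lf cf] /asboolP[lg cg]; apply/asboolP; split.
  move=> b x y; rewrite !fctE lf lg !scalerDr !scalerA.
  by rewrite [a * b]mulrC addrACA.
move=> x; apply: (@cvgD _ _ _ _ _ (a *: f) g _ _ _ (cg x)).
by apply: cvgZr; exact: cf.
Qed.

HB.instance Definition _ := GRing.isSubmodClosed.Build _ _
  continuous_functional continuous_functional_submod.
HB.instance Definition _ := [SubChoice_isSubLmodule of dual by <:].

Lemma dual_linear (f : dual) : linear f.
Proof. by have /asboolP[] := valP f. Qed.

Lemma dual_continuous (f : dual) : continuous f.
Proof. by have /asboolP[] := valP f. Qed.

Definition dual_norm (f : dual) : R := opnorm_on setT f.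

Let linear_dual (f : dual) : {linear X -> R^o} :=
  HB.pack (f : X -> R^o) (GRing.isLinear.Build _ _ _ _ _ (dual_linear f)).

Lemma dual_bounded (f : dual) :
  has_sup [set `|f x| | x in setT `&` [set x | `|x| <= 1]].
Proof.
split; first by exists `|f 0|, 0 => //=; rewrite normr0.
have /linear_bounded_continuous/bounded_funP/(_ 1)[M fM] :
  continuous (linear_dual f) by exact: dual_continuous.
by exists M => _ [x [_ /= x1] <-]; exact: fM.
Qed.

Lemma dual_norm_ge (f : dual) x : `|f x| <= dual_norm f * `|x|.
Proof.
have [->|x0] := eqVneq x 0.
  by rewrite [f 0](linear0 (linear_dual f)) !normr0 mulr0.
rewrite -ler_pdivrMr ?normr_gt0//.
have -> : `|f x| / `|x| = `|f (`|x|^-1 *: x)|.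
  rewrite [f (_ *: x)](linearZZ (linear_dual f)).
  by rewrite normrZ normfV normr_id mulrC.
apply: sup_upper_bound; first exact: dual_bounded.
exists (`|x|^-1 *: x) => //; split => //=.
by rewrite normrZ normfV normr_id mulVf ?normr_eq0.
Qed.

Lemma dual_norm_le (f : dual) M :
  (forall x, `|x| <= 1 -> `|f x| <= M) -> dual_norm f <= M.
Proof.
move=> fM; apply: sup_le_ub; first by case: (dual_bounded f).
by move=> _ [x [_ /= x1] <-]; exact: fM.
Qed.

Lemma dual_norm_ge0 f : 0 <= dual_norm f.
Proof.
apply: (le_trans (normr_ge0 (f 0))); apply: sup_upper_bound.
  exact: dual_bounded.
by exists 0 => //; split => //=; rewrite normr0.
Qed.

Let dual_normD f g : dual_norm (f + g) <= dual_norm f + dual_norm g.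
Proof.
apply: dual_norm_le => x x1; rewrite (le_trans (ler_normD _ _))// lerD//.
  by rewrite (le_trans (dual_norm_ge f x))// ler_piMr ?dual_norm_ge0.
by rewrite (le_trans (dual_norm_ge g x))// ler_piMr ?dual_norm_ge0.
Qed.

Let dual_normZ_le (a : R) f : dual_norm (a *: f) <= `|a| * dual_norm f.
Proof.
apply: dual_norm_le => x x1; rewrite [X in `|X|]/= normrZ ler_wpM2l//.
by rewrite (le_trans (dual_norm_ge f x))// ler_piMr ?dual_norm_ge0.
Qed.

Let dual_normZ (a : R) f : dual_norm (a *: f) = `|a| * dual_norm f.
Proof.
apply/eqP; rewrite eq_le dual_normZ_le/=.
have [->|a0] := eqVneq a 0; first by rewrite normr0 mul0r dual_norm_ge0.
rewrite mulrC -ler_pdivlMr ?normr_gt0// mulrC -normfV.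
by rewrite (le_trans _ (dual_normZ_le _ _))// scalerA mulVf// scale1r.
Qed.

Let dual_norm0_eq0 f : dual_norm f = 0 -> f = 0.
Proof.
move=> f0; apply/val_inj/funext => x /=; apply/eqP.
by rewrite -normr_le0 (le_trans (dual_norm_ge f x))// f0 mul0r.
Qed.

HB.instance Definition _ :=
  Lmodule_isNormed.Build R dual dual_normD dual_normZ dual_norm0_eq0.

End Dual.

Section Hilbert.
Variables (R : realType) (H : normedModType R) (ip : {dot H for idfun}).

Definition norm_of_inner_product := forall h : H, ip h h = `|h| ^+ 2.

Section Adjoint.
Variable X : normedModType R.

(* The functional x |-> <A x, h>; the default 0 is never reached for A linear
   and bounded, see [adjointE]. *)
Definition adjoint (A : X -> H) (h : H) : dual X :=
  insubd 0 (fun x => ip (A x) h).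

End Adjoint.

Section Procedure.
Variable Z : normedModType R.
Implicit Types (S : H -> Z) (h : nat -> H).

(* Sequences are indexed from 0, so that [h k] is the (k+1)-st vector. *)
Definition orthogonal_to_previous h (k : nat) : set H :=
  [set v | forall i, (i < k)%N -> ip v (h i) = 0].

Definition j_eigenvalue S h (k : nat) : R :=
  opnorm_on (orthogonal_to_previous h k) S.

(* [h] results from some run of the procedure; once S vanishes on the
   orthogonal complement of the previous vectors, the procedure has stopped
   and the remaining terms of [h] are arbitrary. *)
Definition j_eigenvectors S h :=
  forall k, (exists2 v, orthogonal_to_previous h k v & S v <> 0) ->
    [/\ orthogonal_to_previous h k (h k), `|h k| = 1
      & `|S (h k)| = j_eigenvalue S h k].

Definition j_image S h (k : nat) : Z :=
  (j_eigenvalue S h k)^-1 *: S (h k).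

End Procedure.
End Hilbert.

Lemma adjointE (R : realType) (H : normedModType R) (ip : {dot H for idfun})
    (X : normedModType R) (A : {linear X -> H}) h x :
  norm_of_inner_product ip -> compact_operator A ->
  adjoint ip A h x = ip (A x) h.
Proof.
move=> ipE /compact_operator_continuous cA.
suff ctA : (fun y => ip (A y) h : R^o) \in @continuous_functional R X.
  by rewrite /adjoint /insubd insubT.
have ipC u v : ip u v = ip v u by rewrite hermC expr0 mul1r.
have polar u : ip u h = 2^-1 * (`|u + h| ^+ 2 - `|u| ^+ 2 - `|h| ^+ 2).
  by rewrite -!ipE linearDl !linearDr /= (ipC h u); field.
apply/asboolP; split.
  by move=> a y z; rewrite linearP linearPl.
rewrite [X in continuous X](_ : _ = fun y =>
    2^-1 * (`|A y + h| ^+ 2 - `|A y| ^+ 2 - `|h| ^+ 2)); last first.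
  by apply/funext => y; exact: polar.
move=> y.
have cN z : `|A t + z| ^+ 2 @[t --> y] --> `|A y + z| ^+ 2.
  rewrite expr2; under eq_fun do rewrite expr2.
  by apply: cvgM; apply: cvg_norm; apply: cvgD;
    [exact: cA|exact: cvg_cst|exact: cA|exact: cvg_cst].
have cN0 : `|A t| ^+ 2 @[t --> y] --> `|A y| ^+ 2.
  by have := cN 0; under eq_fun do rewrite addr0; rewrite addr0.
by apply: cvgMr; apply: cvgB; [apply: cvgB|exact: cvg_cst].
Qed.

Section Sums.
Variables (R : realType) (V : normedModType R).

(* s = \sum_j \sum_i t j i as an iterated sum, all series converging in V. *)
Definition iterated_sum (t : nat -> nat -> V) (s : V) :=
  (forall j, cvgn (series (t j))) /\
  series (fun j => limn (series (t j))) @ \oo --> s.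

(* Every arrangement of the terms into a single series converges to s, and so
   does the net of sums over finite sets of indices, which also covers all
   groupings and iterated summations of the terms. *)
Definition unconditional_sum (t : nat -> nat -> V) (s : V) :=
  (forall e : nat -> nat * nat, bijective e ->
     series (fun n => t (e n).1 (e n).2) @ \oo --> s) /\
  summability.partial_sum (fun p : nat * nat => t p.1 p.2)
    @ summability.totally --> s.

Definition in_l2 (u : nat -> R) := cvgn (series (fun n => u n ^+ 2)).

End Sums.

(* Main.v *)
Require Import Defs.
From HB Require Import structures.
From mathcomp Require Import all_boot all_order all_algebra.
From mathcomp Require Import sesquilinear finmap.
From mathcomp Require Import boolp classical_sets functions reals.
From mathcomp Require Import topology normedtype sequences.
From mathcomp Require Import ring lra.
From mathcomp.analysis.showcase Require summability.

(** Write [a i] and [b j] for the eigenvalues of the adjoint A' of [A] and of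
[B], [u j i] for the inner product of [hA i] and [hB j], and [al i] for that of
[A x] and [hA i]. The term of index [(j, i)] is [al i * u j i] times
[B (hB j)].

Since [X] is infinite-dimensional and [A], [B], A' are injective, the procedure
never stops, and [hA] and [hB] are orthonormal. Compactness makes the
eigenvalues come arbitrarily close to 0; a vector orthogonal to all
eigenvectors is contracted by every eigenvalue, so the operator kills it and it
is 0 ([j_eigenvectors_total]). Hence [hA] and [hB] are orthonormal bases, and
expanding [A x] along [hA], then along [hB], gives the iterated sum
([iterated_sum_expansion]).

For the rearrangements, the sum of the [a i * b j * |u j i|] is of no help: it
may diverge for an orthogonal matrix [u] and square summable [a] and [b]. What
helps is that the eigenvectors are extremal: [S] contracts by [lam k]
the vectors orthogonal to the first [k] eigenvectors. By Abel summation, [S]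
remains bounded on combinations of the [h j] even after each [h j] is divided by
[sqrt (lam j)] ([j_eigenvectors_weighted_bound]). Applied to [B] and to A', this
extra room bounds the square of the norm of any finite sum of terms, up to a
constant, by the corresponding sum of [a i * b j * u j i ^ 2]
([weighted_family_bound]). These numbers are at most
[(a i ^ 2 + b j ^ 2) * u j i ^ 2 / 2], and the rows and columns of [u] have
norm at most 1 by Bessel's inequality, so they form a summable family
([double_sum_bound]). The finite sums of terms are therefore Cauchy along the
finite sets of indices, and the rectangles identify their limit as the iterated
sum ([square_dominated_unconditional_sum]). *)

Set Implicit Arguments.
Unset Strict Implicit.
Unset Printing Implicit Defensive.

Import Order.TTheory GRing.Theory Num.Theory.
Import numFieldNormedType.Exports.

Local Open Scope classical_set_scope.
Local Open Scope ring_scope.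

(** * Orthonormal sequences *)

Section InnerProduct.
Variables (R : realType) (H : completeNormedModType R) (ip : {dot H for idfun}).
Hypothesis ipE : norm_of_inner_product ip.

Lemma ipC u v : ip u v = ip v u.
Proof. by rewrite hermC expr0 mul1r. Qed.

Lemma ipDl u v w : ip (u + v) w = ip u w + ip v w.
Proof. by rewrite linearDl. Qed.

Lemma ipBl u v w : ip (u - v) w = ip u w - ip v w.
Proof. by rewrite linearBl. Qed.

Lemma ipZl a u w : ip (a *: u) w = a * ip u w.
Proof. by rewrite linearZl_LR. Qed.

Lemma ip0l w : ip 0 w = 0.
Proof. by rewrite linear0l. Qed.

Lemma ip_suml (I : Type) (r : seq I) (P : pred I) (f : I -> H) w :
  ip (\sum_(i <- r | P i) f i) w = \sum_(i <- r | P i) ip (f i) w.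
Proof. by rewrite linear_sumlz. Qed.

Lemma ip_sumr (I : Type) (r : seq I) (P : pred I) (f : I -> H) w :
  ip w (\sum_(i <- r | P i) f i) = \sum_(i <- r | P i) ip w (f i).
Proof. by rewrite ipC ip_suml; apply: eq_bigr => i _; rewrite ipC. Qed.

Lemma ipZr a u w : ip w (a *: u) = a * ip w u.
Proof. by rewrite ipC ipZl ipC. Qed.

Lemma ipDr u v w : ip w (u + v) = ip w u + ip w v.
Proof. by rewrite !(ipC w) ipDl. Qed.

Lemma ipBr u v w : ip w (u - v) = ip w u - ip w v.
Proof. by rewrite !(ipC w) ipBl. Qed.

Lemma ip_le u v : ip u v <= `|u| * `|v|.
Proof.
have : `|u + v| ^+ 2 <= (`|u| + `|v|) ^+ 2.
  by rewrite ler_sqr ?nnegrE ?addr_ge0//; exact: ler_normD.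
by rewrite sqrrD -!ipE ipDl !ipDr (ipC v u); lra.
Qed.

Lemma ip_norm_le u v : `|ip u v| <= `|u| * `|v|.
Proof.
rewrite ler_norml ip_le andbT lerNl -mulN1r -ipZl scaleN1r.
by rewrite (le_trans (ip_le _ _))// normrN.
Qed.

Lemma ip_cvg (f : nat -> H) u v :
  f @ \oo --> u -> (fun n => ip (f n) v) @ \oo --> (ip u v : R^o).
Proof.
move=> fu; have v1 : 0 < `|v| + 1 by rewrite ltr_wpDl.
 apply/cvgrPdist_le => e e0; near=> n.
rewrite -ipBl (le_trans (ip_norm_le _ _))//.
rewrite (@le_trans _ _ (`|u - f n| * (`|v| + 1)))//.
  by rewrite ler_wpM2l// lerDl.
rewrite -ler_pdivlMr//; near: n.
have /cvgrPdist_le := fu; apply.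
exact: divr_gt0.
Unshelve. all: by end_near. Qed.

Definition orthonormal_seq (h : nat -> H) :=
  forall i j, ip (h i) (h j) = (i == j)%:R.

Section Orthonormal.
Variable h : nat -> H.
Hypothesis hON : orthonormal_seq h.

Lemma ip_orthonormal_sum n (c : nat -> R) i :
  ip (\sum_(0 <= j < n) c j *: h j) (h i) = if (i < n)%N then c i else 0.
Proof.
rewrite ip_suml.
under eq_bigr do rewrite ipZl hON.
case: ifPn => [ni|]; last rewrite -leqNgt => ni.
  rewrite big_mkord (bigD1 (Ordinal ni))//= eqxx mulr1 big1 ?addr0// => j ji.
  by rewrite (_ : (_ == i) = false) ?mulr0//; apply/negbTE.
rewrite big_nat big1// => j /= jn.
by rewrite ltn_eqF ?mulr0// (leq_trans _ ni).
Qed.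

Lemma norm_orthonormal_sum (r : seq nat) (c : nat -> R) : uniq r ->
  `|\sum_(j <- r) c j *: h j| ^+ 2 = \sum_(j <- r) c j ^+ 2.
Proof.
elim: r => [|k r IH]; first by rewrite !big_nil normr0 expr0n.
move=> /= /andP[kr ur]; rewrite !big_cons -IH// -!ipE.
set s := \sum_(j <- r) c j *: h j; have o : ip (h k) s = 0.
  rewrite ip_sumr big_seq big1// => j jr; rewrite ipZr hON.
  by case: eqP => [kj|]; [rewrite kj jr in kr|rewrite mulr0].
by rewrite ipDl !ipDr (ipC s (c k *: h k)) !ipZl ipZr hON eqxx o mulr1 mulr0 addr0 add0r expr2.
Qed.

Lemma bessel (r : seq nat) v : uniq r ->
  \sum_(j <- r) ip v (h j) ^+ 2 <= `|v| ^+ 2.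
Proof.
move=> ur; set s := \sum_(j <- r) ip v (h j) *: h j.
have sE : ip v s = \sum_(j <- r) ip v (h j) ^+ 2.
  by rewrite ip_sumr; apply: eq_bigr => j _; rewrite ipZr expr2.
have : 0 <= `|v - s| ^+ 2 by rewrite sqr_ge0.
rewrite -ipE ipBl !ipBr (ipC s v) !ipE norm_orthonormal_sum// sE; lra.
Qed.

Lemma bessel_cvg v : cvgn (series (fun i => ip v (h i) ^+ 2)).
Proof.
apply: nondecreasing_is_cvgn.
  by apply/nondecreasing_seqP => n; rewrite seriesSr lerDl sqr_ge0.
by exists (`|v| ^+ 2) => _ [n _ <-]; apply: bessel; exact: iota_uniq.
Qed.

Lemma orthonormal_coef_small v e : 0 < e ->
  \forall n \near \oo, `|ip v (h n)| < e.
Proof.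
move=> e0; have /cvgr0Pnorm_lt/(_ _ (exprn_gt0 2 e0)) :=
  cvg_series_cvg_0 (@bessel_cvg v).
by apply: filterS => n; rewrite /= normrX ltr_sqr ?nnegrE// ltW.
Qed.

(** The remainder of a Fourier expansion is orthogonal to every [h i], so
totality makes it vanish; its existence rests on the completeness of [H]. *)
Lemma fourier_expansion v :
  (forall w, (forall i, ip w (h i) = 0) -> w = 0) ->
  series (fun i => ip v (h i) *: h i) @ \oo --> v.
Proof.
move=> htotal; set s := series _.
have cs : cvgn s.
  apply/cauchy_cvgP/cauchy_seriesP => e e0.
  have /cauchy_cvgP/cauchy_seriesP/(_ _ (exprn_gt0 2 e0)) := @bessel_cvg v.
  apply: filterS => -[m n] /=.
  rewrite ger0_norm; last by apply: sumr_ge0 => i _; rewrite sqr_ge0.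
  rewrite -norm_orthonormal_sum ?iota_uniq//.
  by rewrite ltr_sqr ?nnegrE//; exact: ltW.
suff -> : v = limn s by [].
apply/eqP; rewrite -subr_eq0; apply/eqP/htotal => i; rewrite ipBl.
apply/eqP; rewrite subr_eq0; apply/eqP.
have /ip_cvg-/(_ (h i)) := cs; move/cvg_lim => <-//.
apply/esym/cvg_lim => //; apply: cvg_near_cst.
near=> n; rewrite ip_orthonormal_sum ifT//; near: n.
exact: nbhs_infty_gt.
Unshelve. all: by end_near. Qed.

End Orthonormal.
End InnerProduct.

(** * Infinite-dimensional spaces *)

(** A family whose images have maximal rank spans [X] when [f] is injective:
the image of one more vector depends linearly on the others. *)
Lemma infinite_dimensional_kernel (R : realType) (X : normedModType R) k
    (f : {linear X -> 'rV[R]_k}) :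
  infinite_dimensional X -> exists2 x, x != 0 & f x = 0.
Proof.
move=> Xinf; apply: contrapT => nox; apply: Xinf.
have finj x : f x = 0 -> x = 0.
  by move=> fx; apply: contrapT => /eqP x0; apply: nox; exists x.
pose M m (x : 'I_m -> X) := \matrix_(i < m) f (x i).
pose P r := `[< exists m (x : 'I_m -> X), \rank (M m x) = r >].
have P0 : exists r, P r.
  by exists (\rank (M 0 (fun=> 0))); apply/asboolP; exists 0%N, (fun=> 0).
have Pk r : P r -> (r <= k)%N.
  by move=> /asboolP[m [x <-]]; exact: rank_leq_col.
have [r /asboolP[m [x rx]] rmax] := ex_maxnP P0 Pk.
exists m, x => y.
pose x' (i : 'I_(1 + m)) := match fintype.split i with inl _ => y | inr j => x j end.
have Mx' : M _ x' = col_mx (f y) (M m x).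
  apply/row_matrixP => i; rewrite rowK /x'; case: split_ordP => j ->.
    by rewrite rowKu row_id.
  by rewrite rowKd rowK.
have : (M m x <= M _ x')%MS by rewrite Mx' -addsmxE addsmxSr.
move/mxrank_leqif_sup => [_ /esym].
rewrite rx eqn_leq rmax ?andbT; last by apply/asboolP; exists (1 + m)%N, x'.
rewrite -rx mxrankS ?Mx' -?addsmxE ?addsmxSr// addsmx_sub => /andP[+ _].
move=> /submxP[D fyD]; exists (fun i => D 0 i).
apply/eqP; rewrite -subr_eq0; apply/eqP/finj; rewrite linearB linear_sum /= fyD.
rewrite mulmx_sum_row -sumrB big1// => i _.
by rewrite rowK linearZ subrr.
Qed.

Lemma infinite_dimensional_orthogonal (R : realType)
    (X : normedModType R) (H : completeNormedModType R)
    (ip : {dot H for idfun}) (A : {linear X -> H}) :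
  infinite_dimensional X -> trivial_kernel A ->
  forall k (w : nat -> H),
    exists2 v, v != 0 & forall i, (i < k)%N -> ip v (w i) = 0.
Proof.
move=> Xinf Aker k w; pose f x : 'rV[R]_k := \row_(i < k) ip (A x) (w i).
have lf : linear f.
  by move=> a x y; apply/rowP => i; rewrite !mxE linearP linearPl.
pose F : {linear X -> 'rV[R]_k} := HB.pack f (GRing.isLinear.Build _ _ _ _ _ lf).
have [x x0 /rowP fx] := infinite_dimensional_kernel F Xinf.
exists (A x); first by apply: contra_neq x0; exact: Aker.
by move=> i ik; have := fx (Ordinal ik); rewrite !mxE.
Qed.

(** * The j-eigenvector procedure *)

Section Procedure.
Variables (R : realType) (H : completeNormedModType R) (ip : {dot H for idfun}).
Hypothesis ipE : norm_of_inner_product ip.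
(* This form of infinite dimension gives a nonzero vector at each step of the *)
(* procedure before the orthonormality of [h] is known. *)
Hypothesis Hinf : forall k (w : nat -> H),
  exists2 v, v != 0 & forall i, (i < k)%N -> ip v (w i) = 0.
Variables (Z : normedModType R) (S : {linear H -> Z}) (M : R).
Hypothesis S_le : forall v, `|S v| <= M * `|v|.
Hypothesis Sker : trivial_kernel S.
Variable h : nat -> H.
Hypothesis hS : j_eigenvectors ip S h.

Let lam := j_eigenvalue ip S h.

Lemma j_eigenvalue_bound k v : orthogonal_to_previous ip h k v ->
  `|S v| <= lam k * `|v|.
Proof.
move=> vk; have [->|v0] := eqVneq v 0; first by rewrite linear0 !normr0 mulr0.
have nv : 0 < `|v| by rewrite normr_gt0.
rewrite -ler_pdivrMr//.
have -> : `|S v| / `|v| = `|S (`|v|^-1 *: v)|.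
  by rewrite linearZ/= normrZ normfV normr_id mulrC.
apply: sup_upper_bound; last first.
  exists (`|v|^-1 *: v) => //; split => /=.
    by move=> i ik; rewrite ipZl vk// mulr0.
  by rewrite normrZ normfV normr_id mulVf// gt_eqF.
split.
  exists `|S 0|, 0 => //; split => /=; last by rewrite normr0.
  by move=> i _; rewrite ip0l.
exists `|M| => _ [w [_ /= w1] <-].
rewrite (le_trans (S_le w))// (@le_trans _ _ (`|M| * `|w|))//.
  by rewrite ler_wpM2r// ler_norm.
by rewrite ler_piMr.
Qed.

Lemma j_eigenvectorsP k :
  [/\ orthogonal_to_previous ip h k (h k), `|h k| = 1 & `|S (h k)| = lam k].
Proof.
apply: hS; have [v v0 vk] := Hinf k h.
by exists v => // /Sker ve; rewrite ve eqxx in v0.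
Qed.

Lemma j_eigenvectors_orthonormal : orthonormal_seq ip h.
Proof.
move=> i j; case: ltngtP => [ij|ji|->].
- by rewrite ipC; have [+ _ _] := j_eigenvectorsP j; apply.
- by have [+ _ _] := j_eigenvectorsP i; apply.
- by rewrite ipE; have [_ -> _] := j_eigenvectorsP j; rewrite expr1n.
Qed.

Lemma norm_j_eigenvector k : `|h k| = 1.
Proof. by case: (j_eigenvectorsP k). Qed.

Lemma norm_image_j_eigenvector k : `|S (h k)| = lam k.
Proof. by case: (j_eigenvectorsP k). Qed.

Lemma j_eigenvalue_gt0 k : 0 < lam k.
Proof.
rewrite -norm_image_j_eigenvector normr_gt0; apply/eqP => /Sker h0.
by have := norm_j_eigenvector k; rewrite h0 normr0 => /esym/eqP; rewrite oner_eq0.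
Qed.

Lemma j_eigenvalueS k : lam k.+1 <= lam k.
Proof.
rewrite -norm_image_j_eigenvector (le_trans (j_eigenvalue_bound (k := k) _))//.
  have [+ _ _] := j_eigenvectorsP k.+1.
  by move=> o i ik; apply: o; rewrite ltnS ltnW.
by rewrite norm_j_eigenvector mulr1.
Qed.

Lemma j_imageK k : lam k *: j_image ip S h k = S (h k).
Proof.
by rewrite scalerA divff ?scale1r// gt_eqF// j_eigenvalue_gt0.
Qed.

(** A vector orthogonal to every [h k] satisfies [|S v| <= lam k * |v|] for
all [k], so [S v = 0] as soon as the eigenvalues come close to 0. *)
Lemma j_eigenvectors_total :
  (forall e, 0 < e -> exists k, `|S (h k)| < e) ->
  forall v, (forall i, ip v (h i) = 0) -> v = 0.
Proof.
move=> S0 v vh; apply/Sker/eqP; rewrite -normr_le0; apply/ler_addgt0Pl => e e0.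
have v1 : 0 < `|v| + 1 by rewrite ltr_wpDl.
have [k] := S0 (e / (`|v| + 1)) (divr_gt0 e0 v1).
rewrite norm_image_j_eigenvector addr0 ltr_pdivlMr// => /ltW ke.
rewrite (le_trans (j_eigenvalue_bound (k := k) _))// (le_trans _ ke)//.
by rewrite ler_wpM2l ?ltW ?j_eigenvalue_gt0// ltrDl.
Qed.

Let w k := (Num.sqrt (lam k))^-1.

(** The weights [1 / sqrt (lam j)] may be unbounded, but their increment at [k]
only meets a vector that [S] contracts by [lam k], and
[(1 / sqrt (lam k) - 1 / sqrt (lam (k - 1))) * lam k] is at most
[sqrt (lam (k - 1)) - sqrt (lam k)]: these bounds telescope. *)
Lemma j_eigenvectors_weighted_bound (c : nat -> R) n :
  `|S (\sum_(0 <= j < n) (c j / Num.sqrt (lam j)) *: h j)| ^+ 2 <=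
  4 * lam 0 * \sum_(0 <= j < n) c j ^+ 2.
Proof.
pose tl k := \sum_(k <= j < n) c j *: h j.
set C := \sum_(0 <= j < n) _ ^+ 2.
have C0 : 0 <= C by apply: sumr_ge0 => j _; rewrite sqr_ge0.
pose N := Num.sqrt C.
have tlN k : `|tl k| <= N.
  have [nk|kn] := leqP n k; first by rewrite /tl big_geq// normr0 sqrtr_ge0.
  rewrite -ler_sqr ?nnegrE ?sqrtr_ge0// sqr_sqrtr//.
  rewrite (norm_orthonormal_sum ipE j_eigenvectors_orthonormal) ?iota_uniq//.
  rewrite /C (big_cat_nat (leq0n k) (ltnW kn))/= lerDr.
  by apply: sumr_ge0 => j _; rewrite sqr_ge0.
have Stl k : `|S (tl k)| <= lam k * N.
  rewrite (le_trans (j_eigenvalue_bound (k := k) _))//.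
    move=> i ik; rewrite ip_suml big_nat big1// => j /andP[kj _].
    rewrite ipZl j_eigenvectors_orthonormal gtn_eqF ?mulr0//.
    exact: leq_trans kj.
  by rewrite ler_wpM2l// ltW// j_eigenvalue_gt0.
have l0 k : 0 < Num.sqrt (lam k) by rewrite sqrtr_gt0 j_eigenvalue_gt0.
have sq k : lam k = Num.sqrt (lam k) ^+ 2.
  by rewrite sqr_sqrtr// ltW// j_eigenvalue_gt0.
(* [q k] is what remains of the weighted sum past [k] once the weight [w k], *)
(* common to all these terms, is removed; it is bounded from the end. *)
pose q k := \sum_(k <= j < n) (c j * (w j - w k)) *: h j.
have qS k : (k < n)%N -> q k = q k.+1 + (w k.+1 - w k) *: tl k.+1.
  move=> kn; rewrite /q big_ltn// subrr mulr0 scale0r add0r /tl scaler_sumr.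
  rewrite -big_split/=; apply: eq_bigr => j _; rewrite scalerA -scalerDl.
  by congr (_ *: _); ring.
have Sq d k : (n <= k + d)%N -> `|S (q k)| <= Num.sqrt (lam k) * N.
  elim: d k => [|d IH] k nkd; have [nk|kn] := leqP n k.
  - by rewrite /q big_geq// linear0 normr0 mulr_ge0 ?sqrtr_ge0.
  - by rewrite addn0 leqNgt kn in nkd.
  - by rewrite /q big_geq// linear0 normr0 mulr_ge0 ?sqrtr_ge0.
  rewrite qS// linearD linearZ/= (le_trans (ler_normD _ _))// normrZ.
  have sk : Num.sqrt (lam k.+1) <= Num.sqrt (lam k).
    by rewrite ler_sqrt ?j_eigenvalueS// ltW// j_eigenvalue_gt0.
  have wk : w k <= w k.+1 by rewrite lef_pV2 ?posrE.
  rewrite ger0_norm ?subr_ge0//.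
  have ? : (w k.+1 - w k) * `|S (tl k.+1)| <=
      (Num.sqrt (lam k) - Num.sqrt (lam k.+1)) * N.
    rewrite (@le_trans _ _ ((w k.+1 - w k) * (lam k.+1 * N)))//.
      by rewrite ler_wpM2l ?subr_ge0.
    rewrite mulrA ler_wpM2r ?sqrtr_ge0//.
    have -> : (w k.+1 - w k) * lam k.+1 =
        (Num.sqrt (lam k) - Num.sqrt (lam k.+1)) *
        (Num.sqrt (lam k.+1) / Num.sqrt (lam k)).
      rewrite {1}[lam k.+1]sq /w; field.
      by rewrite !gt_eqF.
    by rewrite ler_piMr ?subr_ge0// ler_pdivrMr// mul1r.
  have := IH k.+1; rewrite addSnnS => /(_ nkd); lra.
have -> : \sum_(0 <= j < n) (c j / Num.sqrt (lam j)) *: h j =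
    q 0 + w 0 *: tl 0.
  rewrite scaler_sumr -big_split/=; apply: eq_bigr => j _.
  by rewrite scalerA -scalerDl -/(w j); congr (_ *: _); ring.
have : `|S (q 0 + w 0 *: tl 0)| <= 2 * Num.sqrt (lam 0) * N.
  rewrite linearD linearZ/= (le_trans (ler_normD _ _))// normrZ.
  have := Sq n 0 (leqnn n); rewrite ger0_norm ?invr_ge0 ?sqrtr_ge0//.
  have : w 0 * `|S (tl 0)| <= Num.sqrt (lam 0) * N.
    rewrite ler_pdivrMl// (le_trans (Stl 0))// {1}sq expr2 mulrA//.
  lra.
rewrite -ler_sqr ?nnegrE ?mulr_ge0 ?sqrtr_ge0// => /le_trans; apply.
by rewrite !exprMn -sq sqr_sqrtr// -natrX.
Qed.

End Procedure.

(** * Compact operators and orthonormal sequences *)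

Lemma compact_operator_bound (R : realType) (V W : normedModType R)
    (f : {linear V -> W}) :
  compact_operator f -> exists2 M, 0 <= M & forall x, `|f x| <= M * `|x|.
Proof.
move=> /compact_operator_continuous/linear_bounded_continuous/linear_boundedP.
by move=> /pinfty_ex_gt0[M M0 fM]; exists M => //; exact: ltW.
Qed.

Lemma compact_operator_cluster (R : realType) (V W : normedModType R)
    (f : V -> W) (u : nat -> V) :
  compact_operator f -> (forall n, `|u n| <= 1) ->
  exists y, forall e, 0 < e -> forall n, exists2 m, (n <= m)%N & `|y - f (u m)| < e.
Proof.
rewrite /compact_operator precompactE => cf u1.
have [|y [_ yc]] := cf (f \o u @ \oo) _.
  by exists 0%N => // n _; apply: subset_closure; exists (u n) => //=; exact: u1.
exists y => e e0 n.
have fun_n : (f \o u @ \oo) [set f (u m) | m in [set m | (n <= m)%N]].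
  by exists n => // m nm; exists m.
have [_ [[m nm <-] ym]] := yc _ _ fun_n (nbhsx_ballx y e e0).
by exists m => //; move: ym; rewrite -ball_normE.
Qed.

Section CompactOperators.
Variables (R : realType) (H : completeNormedModType R) (ip : {dot H for idfun}).
Hypothesis ipE : norm_of_inner_product ip.
Variable h : nat -> H.
Hypothesis hON : orthonormal_seq ip h.

Let norm_h n : `|h n| = 1.
Proof.
by apply/eqP; rewrite -(@eqrXn2 _ 2)// -ipE hON eqxx expr1n.
Qed.

(** Averages of [N] of the [h k] have norm [1 / sqrt N], so a cluster point of
[B (h k)], being approximated by images of such averages, is 0. *)
Lemma compact_operator_orthonormal_small (Y : normedModType R)
    (B : {linear H -> Y}) : compact_operator B ->
  forall e, 0 < e -> exists k, `|B (h k)| < e.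
Proof.
move=> cB e e0; have [M M0 BM] := compact_operator_bound cB.
have h1 n : `|h n| <= 1 by rewrite norm_h.
have [y yc] := compact_operator_cluster cB h1.
have [d d0 de] : exists2 d, 0 < d & e = 4 * d.
  exists (e / 4); first exact: divr_gt0.
  lra.
have close N : exists r : seq nat,
    [/\ uniq r, size r = N & forall k, k \in r -> `|y - B (h k)| < d].
  elim: N => [|N [r [ur rN rd]]]; first by exists [::].
  have [m rm ym] := yc d d0 (\max_(k <- r) k).+1.
  exists (m :: r); split => /=; last 1 first.
  - by move=> k; rewrite inE => /orP[/eqP->//|/rd].
  - rewrite ur andbT; apply/negP => mr.
    by move: rm; rewrite ltnNge (leq_bigmax_seq m mr).
  - by rewrite rN.
(* [N] is so large that the average of [N] vectors is mapped to norm <= [d]. *)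
pose N := (Num.truncn (M ^+ 2 / d ^+ 2)).+1.
have MN : M ^+ 2 <= d ^+ 2 * N%:R.
  by rewrite mulrC -ler_pdivrMr ?exprn_gt0// ltW// truncnS_gt.
have [r [ur rN rd]] := close N.
set s := \sum_(k <- r) h k.
have s2 : `|s| ^+ 2 = N%:R.
  rewrite /s (eq_bigr (fun k => (1:R) *: h k)) => [|k _]; last by rewrite scale1r.
  rewrite (norm_orthonormal_sum ipE hON)// (eq_bigr (fun=> 1)) => [|k _].
    by rewrite big_const_seq count_predT rN iter_addr_0.
  by rewrite expr1n.
have Bs : `|B s| <= d * N%:R.
  rewrite (le_trans (BM s))// -ler_sqr ?nnegrE ?mulr_ge0 ?(ltW d0)//.
  by rewrite !exprMn s2 [N%:R ^+ 2]expr2 mulrA ler_wpM2r.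
have yN : N%:R *: y = \sum_(k <- r) (y - B (h k)) + B s.
  rewrite sumrB /s (linear_sum B) subrK big_const_seq count_predT rN iter_addr_0.
  by rewrite scaler_nat.
have y2 : `|y| <= 2 * d.
  have N0 : 0 < N%:R :> R by rewrite ltr0n.
  rewrite -(ler_pM2l N0) -{1}(normr_nat R N) -normrZ yN.
  rewrite (le_trans (ler_normD _ _))//.
  have -> : N%:R * (2 * d) = N%:R * d + d * N%:R by ring.
  rewrite lerD// (le_trans (ler_norm_sum _ _ _))// big_seq.
  rewrite (le_trans (ler_sum _ (G := fun=> d) _))//; first by move=> k /rd/ltW.
  by rewrite -big_seq big_const_seq count_predT rN iter_addr_0 mulr_natl.
have [k _ yk] := yc d d0 0%N; exists k.
rewrite -[B (h k)](subKr y) (le_lt_trans (ler_normB _ _))//.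
rewrite (@lt_le_trans _ _ (2 * d + d))// ?ler_ltD// de; lra.
Qed.

Section Adjoint.
Variables (X : normedModType R) (A : {linear X -> H}).
Hypothesis cA : compact_operator A.

Lemma adjoint_is_linear : linear (adjoint ip A).
Proof.
move=> a u v; apply/val_inj/funext => x /=.
rewrite [LHS](adjointE _ _ ipE cA).
rewrite [RHS](_ : _ = a * adjoint ip A u x + adjoint ip A v x)//.
by rewrite !(adjointE _ _ ipE cA) ipDr ipZr.
Qed.

Lemma adjoint_bound :
  exists M, forall v, `|adjoint ip A v| <= M * `|v|.
Proof.
have [M M0 AM] := compact_operator_bound cA; exists M => v.
apply: dual_norm_le => x x1; rewrite (adjointE _ _ ipE cA).
rewrite (le_trans (ip_norm_le ipE _ _))// ler_wpM2r// (le_trans (AM x))//.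
by rewrite ler_piMr.
Qed.

(** A vector [v] killed by the adjoint is orthogonal to the range of [A], so no
point of the range is closer to [v] than the origin is; density forces [v = 0]. *)
Lemma adjoint_trivial_kernel :
  dense (range A) -> trivial_kernel (adjoint ip A).
Proof.
move=> dA v Av; apply/eqP; apply: contrapT => /negP v0.
have nv : 0 < `|v| by rewrite normr_gt0.
have [||w [/= vw [x _ xE]]] := dA (ball v `|v|).
- by exists v; exact: ballxx.
- exact: ball_open.
move: vw; rewrite -xE -ball_normE /= => vx.
have : ip (v - A x) v <= `|v - A x| * `|v| by exact: ip_le.
rewrite ipBl -(adjointE _ _ ipE cA) Av [X in _ - X](_ : _ = 0)// subr0 ipE.
by rewrite expr2 ler_pM2r// leNgt vx.
Qed.

(** If these norms stayed above [e], points [x k] of the unit ball would give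
[|<A (x k), h k>| > e / 2]. The points [A (x k)] cluster at some [y] by
compactness of [A], and [<y, h k>] tends to 0 by Bessel's inequality. *)
Lemma adjoint_orthonormal_small e :
  0 < e -> exists k, `|adjoint ip A (h k)| < e.
Proof.
move=> e0; apply: contrapT => nok.
have d0 : 0 < e / 4 by rewrite divr_gt0.
have /choice[x xP] : forall k, exists x, `|x| <= 1 /\ e / 2 < `|ip (A x) (h k)|.
  move=> k; apply: contrapT => nox.
  suff : `|adjoint ip A (h k)| <= e / 2.
    by move=> ke; apply: nok; exists k; lra.
  apply: dual_norm_le => x x1; rewrite (adjointE _ _ ipE cA) leNgt; apply/negP.
  by move=> xk; apply: nox; exists x.
have [y yc] := compact_operator_cluster cA (fun n => (xP n).1).
have [n _ yn] := orthonormal_coef_small ipE hON y d0.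
have [m nm ym] := yc _ d0 n.
have := yn m nm; have [_] := xP m.
have : `|ip (A (x m)) (h m)| <= `|ip y (h m)| + `|y - A (x m)|.
  rewrite -[A (x m)](subKr y) ipBl (le_trans (ler_normB _ _))// lerD2l subKr.
  by rewrite (le_trans (ip_norm_le ipE _ _))// norm_h mulr1.
lra.
Qed.

End Adjoint.
End CompactOperators.

(** * Unconditional summation *)

Definition rectangle m n : seq (nat * nat) :=
  [seq (j, i) | j <- iota 0 m, i <- iota 0 n].

Lemma rectangle_uniq m n : uniq (rectangle m n).
Proof. by apply: allpairs_uniq; rewrite ?iota_uniq// => -[? ?] []. Qed.

Lemma mem_rectangle m n p : (p \in rectangle m n) = (p.1 < m)%N && (p.2 < n)%N.
Proof.
apply/allpairsP/idP => [[[j i] /= [+ + ->]]|]; first by rewrite !mem_iota /= => -> ->.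
by case: p => j i /= /andP[jm ni]; exists (j, i); rewrite !mem_iota/=.
Qed.

Lemma big_rectangle (V : zmodType) (f : nat * nat -> V) m n :
  \sum_(p <- rectangle m n) f p = \sum_(0 <= j < m) \sum_(0 <= i < n) f (j, i).
Proof. by rewrite big_allpairs /index_iota !subn0. Qed.

Lemma sub_rectangle (r : seq (nat * nat)) :
  exists N, forall m n, (N <= m)%N -> (N <= n)%N -> {subset r <= rectangle m n}.
Proof.
exists (\max_(p <- r) (maxn p.1 p.2)).+1 => m n Nm Nn p pr.
have := leq_bigmax_seq (F := fun p => maxn p.1 p.2) p pr isT.
rewrite geq_max mem_rectangle => /andP[p1 p2].
by rewrite (leq_ltn_trans p1)// (leq_ltn_trans p2).
Qed.

Lemma big_sub_uniq (V : zmodType) (I : eqType) (r r' : seq I) (f : I -> V) :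
  uniq r -> uniq r' -> {subset r <= r'} ->
  \sum_(p <- r') f p = \sum_(p <- r) f p + \sum_(p <- r' | p \notin r) f p.
Proof.
move=> ur ur' rr'; rewrite (bigID (mem r))/= -big_filter; congr (_ + _).
apply: perm_big; apply: uniq_perm; rewrite ?filter_uniq// => p.
by rewrite mem_filter; case: (boolP (p \in r)) => // /rr' ->.
Qed.

Section UnconditionalSum.
Variables (R : realType) (V : normedModType R).
Variables (t : nat * nat -> V) (g : nat * nat -> R) (M : R).
Hypothesis g_bound : forall r, uniq r -> \sum_(p <- r) g p <= M.
Hypothesis t_le_g : forall r, uniq r ->
  `|\sum_(p <- r) t p| ^+ 2 <= \sum_(p <- r) g p.

(** Take [r] such that the sum of [g] over [r] nearly attains its supremum: any
finite set disjoint from [r] adds little to it. *)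
Lemma finite_sums_cauchy d : 0 < d -> exists2 r, uniq r &
  forall r', uniq r' -> {subset r <= r'} ->
    `|\sum_(p <- r') t p - \sum_(p <- r) t p| <= d.
Proof.
move=> d0; pose E := [set \sum_(p <- r) g p | r in [set r | uniq r]].
have Esup : has_sup E.
  split; first by exists (\sum_(p <- [::]) g p), [::].
  by exists M => _ [r /= ur <-]; exact: g_bound.
have [w [r /= ur wE] rE] := sup_adherent (exprn_gt0 2 d0) Esup.
exists r => // r' ur' rr'; rewrite -wE in rE.
rewrite (big_sub_uniq _ ur ur' rr') addrAC subrr add0r -ler_sqr ?nnegrE ?(ltW d0)//.
rewrite -big_filter (le_trans (t_le_g _)) ?filter_uniq// big_filter.
have : \sum_(p <- r') g p <= sup E.
  by apply: sup_upper_bound => //; exists r'.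
rewrite (big_sub_uniq _ ur ur' rr'); lra.
Qed.

(** The iterated sum is a limit of sums over rectangles containing [r], all of
which satisfy the estimate. *)
Lemma iterated_sum_approx s r d :
  iterated_sum (fun j i => t (j, i)) s -> uniq r ->
  (forall r', uniq r' -> {subset r <= r'} ->
    `|\sum_(p <- r') t p - \sum_(p <- r) t p| <= d) ->
  `|s - \sum_(p <- r) t p| <= d.
Proof.
move=> [ct ts] ur rd; have [N rN] := sub_rectangle r.
set s0 := \sum_(p <- r) t p.
have rowd m : (N <= m)%N ->
    `|\sum_(0 <= j < m) limn (series (fun i => t (j, i))) - s0| <= d.
  move=> Nm.
  have cm : (fun n => `|\sum_(0 <= j < m) series (fun i => t (j, i)) n - s0|) @ \oo
      --> `|\sum_(0 <= j < m) limn (series (fun i => t (j, i))) - s0|.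
    apply: cvg_norm; apply: cvgB; last exact: cvg_cst.
    apply: (cvg_big (op := +%R)) => [|j _]; last exact: ct.
    exact: add_continuous.
  apply: (cvgr_to_le cm); near=> n.
  rewrite -(big_rectangle t m n); apply: rd; first exact: rectangle_uniq.
  by apply: rN => //; near: n; exact: nbhs_infty_ge.
have cs : (fun m => `|series (fun j => limn (series (fun i => t (j, i)))) m - s0|)
    @ \oo --> `|s - s0|.
  by apply: cvg_norm; apply: cvgB => //; exact: cvg_cst.
apply: (cvgr_to_le cs); near=> m; apply: rowd; near: m; exact: nbhs_infty_ge.
Unshelve. all: by end_near. Qed.

Lemma square_dominated_unconditional_sum s :
  iterated_sum (fun j i => t (j, i)) s ->
  unconditional_sum (fun j i => t (j, i)) s.
Proof.
move=> ts.
have approx d : 0 < d -> exists2 r, uniq r &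
    forall r', uniq r' -> {subset r <= r'} -> `|s - \sum_(p <- r') t p| <= d.
  move=> d0; have d20 : 0 < d / 2 by rewrite divr_gt0.
  have [r ur rd] := finite_sums_cauchy d20; exists r => // r' ur' rr'.
  have := rd r' ur' rr'; have := iterated_sum_approx ts ur rd.
  have := ler_distD (\sum_(p <- r) t p) s (\sum_(p <- r') t p).
  rewrite (distrC (\sum_(p <- r) t p)); lra.
have tE : (fun p : nat * nat => t (p.1, p.2)) = t by apply/funext => -[].
split.
  move=> e [e' eK e'K]; apply/cvgrPdist_le => d d0.
  have [r ur rd] := approx d d0.
  exists (\max_(p <- r) e' p).+1 => // n /= rn.
  rewrite /series /= (eq_bigr (t \o e)); last by move=> i _; rewrite -surjective_pairing.
  rewrite -(big_map e xpredT t); apply: rd.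
    by rewrite map_inj_uniq ?iota_uniq//; exact: can_inj eK.
  move=> p pr; apply/mapP; exists (e' p); last by rewrite e'K.
  by rewrite mem_index_iota /= (leq_ltn_trans _ rn)// leq_bigmax_seq.
have ? := @summability.totally_filter (nat * nat)%type.
rewrite tE; apply/cvgrPdist_le => d d0; have [r ur rd] := approx d d0.
exists [fset p in r]%fset => // F /= /fsubsetP rF.
rewrite /summability.partial_sum -(big_seq_fsetE _ _ xpredT)/=.
apply: rd; first exact: fset_uniq.
by move=> p pr; apply: rF; rewrite inE.
Qed.

End UnconditionalSum.

Lemma sum_cauchy_schwarz (R : realDomainType) (I : Type) (r : seq I) (x y : I -> R) :
  (\sum_(i <- r) x i * y i) ^+ 2 <=
  (\sum_(i <- r) x i ^+ 2) * (\sum_(i <- r) y i ^+ 2).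
Proof.
elim: r => [|k r IH]; first by rewrite !big_nil mulr0 expr0n.
rewrite !big_cons; move: IH.
set P := \sum_(i <- r) _ * _; set X := \sum_(i <- r) x i ^+ 2.
set Y := \sum_(i <- r) _ ^+ 2 => PXY.
have X0 : 0 <= X by apply: sumr_ge0 => i _; rewrite sqr_ge0.
have Y0 : 0 <= Y by apply: sumr_ge0 => i _; rewrite sqr_ge0.
suff : 2 * (P * (x k * y k)) <= X * y k ^+ 2 + x k ^+ 2 * Y by lra.
rewrite (le_trans (ler_norm _))//.
have Xy : 0 <= X * y k ^+ 2 := mulr_ge0 X0 (sqr_ge0 _).
have xY : 0 <= x k ^+ 2 * Y := mulr_ge0 (sqr_ge0 _) Y0.
rewrite -ler_sqr ?nnegrE ?normr_ge0 ?addr_ge0//.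
rewrite -normrX ger0_norm ?sqr_ge0//.
have h1 : P ^+ 2 * (x k * y k) ^+ 2 <= X * Y * (x k * y k) ^+ 2.
  by rewrite ler_wpM2r ?sqr_ge0.
have h2 : 0 <= (X * y k ^+ 2 - x k ^+ 2 * Y) ^+ 2 by rewrite sqr_ge0.
lra.
Qed.

Lemma in_l2_bound (R : realType) (u : nat -> R) : in_l2 u ->
  exists L, forall n, \sum_(0 <= i < n) u i ^+ 2 <= L.
Proof.
move=> cu; exists (limn (series (fun n => u n ^+ 2))) => n.
apply: nondecreasing_cvgn_le => //.
by apply/nondecreasing_seqP => m; rewrite seriesSr lerDl sqr_ge0.
Qed.

Section WeightedFamily.
Variables (R : realType) (V : normedModType R).
Variables (z : nat -> V) (al a b : nat -> R) (Ka Kb : R).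
Hypotheses (a0 : forall i, 0 < a i) (b0 : forall j, 0 < b j).
Hypothesis al_bound : forall n,
  \sum_(0 <= i < n) (al i / Num.sqrt (a i)) ^+ 2 <= Ka.
Hypothesis z_bound : forall c n,
  `|\sum_(0 <= j < n) (c j / Num.sqrt (b j)) *: z j| ^+ 2 <=
  Kb * \sum_(0 <= j < n) c j ^+ 2.

(** In the [j]-th partial sum of [al i * u j i], the factor [sqrt (a i)] taken
from [al i] is left to [u j i] by the Cauchy-Schwarz inequality, and the factor
[sqrt (b j)] is what [z_bound] leaves to the coefficient of [z j]. *)
Lemma weighted_family_bound (u : nat -> nat -> R) r : uniq r ->
  `|\sum_(p <- r) (al p.2 * u p.1 p.2) *: z p.1| ^+ 2 <=
  \sum_(p <- r) Ka * Kb * (a p.2 * b p.1 * u p.1 p.2 ^+ 2).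
Proof.
move=> ur; have [N rN] := sub_rectangle r.
have toN (W : zmodType) (f : nat * nat -> W) : \sum_(p <- r) f p =
    \sum_(0 <= j < N) \sum_(0 <= i < N) (if (j, i) \in r then f (j, i) else 0).
  rewrite -(big_rectangle (fun p => if p \in r then f p else 0)) -big_mkcond/=.
  rewrite -[RHS]big_filter; apply: perm_big; apply: uniq_perm => //.
    by rewrite filter_uniq// rectangle_uniq.
  move=> p; rewrite mem_filter; case: (boolP (p \in r)) => //= pr.
  by rewrite (rN N N).
have sa i : 0 < Num.sqrt (a i) by rewrite sqrtr_gt0.
have sb j : 0 < Num.sqrt (b j) by rewrite sqrtr_gt0.
have Kb0 : 0 <= Kb.
  have := z_bound (fun=> 1) 1; rewrite !big_nat1 expr1n mulr1.
  by apply: le_trans; rewrite sqr_ge0.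
(* The finite set [r] is encoded by setting [u] to 0 outside of it. *)
pose v j i := if (j, i) \in r then u j i else 0.
pose c j := Num.sqrt (b j) * \sum_(0 <= i < N) al i * v j i.
have -> : \sum_(p <- r) (al p.2 * u p.1 p.2) *: z p.1 =
    \sum_(0 <= j < N) (c j / Num.sqrt (b j)) *: z j.
  rewrite toN; apply: eq_bigr => j _.
  rewrite /c mulrAC divff ?gt_eqF// mul1r scaler_suml; apply: eq_bigr => i _.
  by rewrite /v; case: ifP => //=; rewrite mulr0 scale0r.
rewrite (le_trans (z_bound _ _))// -mulr_sumr toN [Ka * Kb]mulrC -mulrA.
rewrite ler_wpM2l// mulr_sumr; apply: ler_sum => j _.
rewrite /c exprMn sqr_sqrtr ?(ltW (b0 _))//.
have -> : \sum_(0 <= i < N) al i * v j i =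
    \sum_(0 <= i < N) (al i / Num.sqrt (a i)) * (Num.sqrt (a i) * v j i).
  by apply: eq_bigr => i _; rewrite mulrA divfK// gt_eqF.
rewrite (le_trans (ler_wpM2l (ltW (b0 j)) (sum_cauchy_schwarz _ _ _)))//.
rewrite (_ : \sum_(0 <= i < N) (if _ then _ else _) =
  b j * \sum_(0 <= i < N) (Num.sqrt (a i) * v j i) ^+ 2); last first.
  rewrite mulr_sumr; apply: eq_bigr => i _; rewrite exprMn sqr_sqrtr ?(ltW (a0 _))//.
  by rewrite /v; case: ifP => _ /=; ring.
rewrite mulrCA ler_wpM2r// mulr_ge0 ?(ltW (b0 j))//.
by apply: sumr_ge0 => i _; rewrite sqr_ge0.
Qed.

End WeightedFamily.

Lemma double_sum_bound (R : realType) (a b : nat -> R) (u : nat -> nat -> R) :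
  in_l2 a -> in_l2 b ->
  (forall i n, \sum_(0 <= j < n) u j i ^+ 2 <= 1) ->
  (forall j n, \sum_(0 <= i < n) u j i ^+ 2 <= 1) ->
  exists K, forall r, uniq r ->
    \sum_(p <- r) a p.2 * b p.1 * u p.1 p.2 ^+ 2 <= K.
Proof.
move=> /in_l2_bound[La aL] /in_l2_bound[Lb bL] ucol urow.
exists ((La + Lb) / 2) => r ur; have [N rN] := sub_rectangle r.
pose g (p : nat * nat) := (a p.2 ^+ 2 + b p.1 ^+ 2) / 2 * u p.1 p.2 ^+ 2.
have g0 p : 0 <= g p by rewrite mulr_ge0 ?sqr_ge0// divr_ge0// addr_ge0 ?sqr_ge0.
apply: (@le_trans _ _ (\sum_(p <- r) g p)).
  apply: ler_sum => p _; rewrite ler_wpM2r ?sqr_ge0//.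
  have := sqr_ge0 (a p.2 - b p.1); lra.
apply: (@le_trans _ _ (\sum_(p <- rectangle N N) g p)).
  rewrite (big_sub_uniq _ ur (rectangle_uniq N N) (rN N N _ _))// lerDl.
  exact: sumr_ge0.
rewrite big_rectangle.
have -> : \sum_(0 <= j < N) \sum_(0 <= i < N) g (j, i) =
    (\sum_(0 <= i < N) a i ^+ 2 * \sum_(0 <= j < N) u j i ^+ 2 +
     \sum_(0 <= j < N) b j ^+ 2 * \sum_(0 <= i < N) u j i ^+ 2) / 2.
  under [X in X + _]eq_bigr do rewrite mulr_sumr.
  rewrite [in RHS]exchange_big/= -big_split/= mulr_suml; apply: eq_bigr => j _.
  rewrite mulr_sumr -big_split/= mulr_suml; apply: eq_bigr => i _.
  by rewrite /g /=; ring.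
rewrite ler_wpM2r ?invr_ge0// lerD//.
  rewrite (le_trans _ (aL N))//; apply: ler_sum => i _.
  by rewrite ler_piMr ?sqr_ge0.
rewrite (le_trans _ (bL N))//; apply: ler_sum => j _.
by rewrite ler_piMr ?sqr_ge0.
Qed.

(** * The double series of a factored operator *)

Lemma iterated_sum_expansion (R : realType) (H : completeNormedModType R)
    (Y : normedModType R) (ip : {dot H for idfun}) (B : {linear H -> Y})
    (f g : nat -> H) v :
  norm_of_inner_product ip -> continuous B ->
  series (fun i => ip v (f i) *: f i) @ \oo --> v ->
  series (fun j => ip v (g j) *: g j) @ \oo --> v ->
  iterated_sum (fun j i => (ip v (f i) * ip (f i) (g j)) *: B (g j)) (B v).
Proof.
move=> ipE cB fv gv.
have rowE j : series (fun i => (ip v (f i) * ip (f i) (g j)) *: B (g j)) @ \oo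
    --> ip v (g j) *: B (g j).
  have -> : series (fun i => (ip v (f i) * ip (f i) (g j)) *: B (g j)) =
      fun n => ip (series (fun i => ip v (f i) *: f i) n) (g j) *: B (g j).
    apply/funext => n; rewrite /series /= ip_suml scaler_suml.
    by apply: eq_bigr => i _; rewrite ipZl.
  by apply: cvgZ; [exact: (ip_cvg ipE fv)|exact: cvg_cst].
split=> [j|]; first by apply/cvg_ex; exists (ip v (g j) *: B (g j)); exact: rowE.
under eq_fun do rewrite (cvg_lim _ (rowE _))//.
have -> : series (fun j => ip v (g j) *: B (g j)) =
    B \o series (fun j => ip v (g j) *: g j).
  apply/funext => n; rewrite /series /= (linear_sum B).
  by apply: eq_bigr => j _; rewrite linearZ.
by apply: (cvg_comp _ _ gv); exact: cB.
Qed.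

(** Testing [j_eigenvectors_weighted_bound] for the adjoint, at the point [x],
on the coefficients [<A x, h i> / sqrt (lam i)] themselves. *)
Lemma adjoint_weighted_coef_bound (R : realType)
    (X : normedModType R) (H : completeNormedModType R)
    (ip : {dot H for idfun}) (A : {linear X -> H}) (lam : nat -> R)
    (h : nat -> H) x :
  norm_of_inner_product ip -> compact_operator A ->
  (forall c n, `|adjoint ip A (\sum_(0 <= j < n) (c j / Num.sqrt (lam j)) *: h j)|
     ^+ 2 <= 4 * lam 0 * \sum_(0 <= j < n) c j ^+ 2) ->
  forall n, \sum_(0 <= i < n) (ip (A x) (h i) / Num.sqrt (lam i)) ^+ 2 <=
    4 * lam 0 * `|x| ^+ 2.
Proof.
move=> ipE cA wb n.
pose c i := ip (A x) (h i) / Num.sqrt (lam i).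
set C := \sum_(0 <= i < n) _.
have : 0 <= C by apply: sumr_ge0 => i _; rewrite sqr_ge0.
set v := \sum_(0 <= j < n) (c j / Num.sqrt (lam j)) *: h j.
have vC : adjoint ip A v x = C.
  rewrite (adjointE _ _ ipE cA) ip_sumr; apply: eq_bigr => i _.
  by rewrite ipZr /c expr2 mulrAC mulrA.
rewrite le_eqVlt => /predU1P[<-|C0].
  rewrite mulr_ge0 ?sqr_ge0//.
  have := wb (fun=> 1) 1; rewrite !big_nat1 expr1n mulr1.
  by apply: le_trans; rewrite sqr_ge0.
have : C ^+ 2 <= 4 * lam 0 * C * `|x| ^+ 2.
  rewrite -[C in C ^+ 2]vC -real_normK ?num_real//.
  rewrite (@le_trans _ _ ((`|adjoint ip A v| * `|x|) ^+ 2))//.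
    by rewrite ler_sqr ?nnegrE ?mulr_ge0//; exact: dual_norm_ge.
  by rewrite exprMn ler_wpM2r ?sqr_ge0//; exact: wb.
by rewrite expr2 mulrAC ler_pM2r.
Qed.

Theorem corollary4p6 (R : realType) (X Y H : completeNormedModType R)
    (ip : {dot H for idfun})
    (T : {linear X -> Y}) (A : {linear X -> H}) (B : {linear H -> Y})
    (hA hB : nat -> H) :
  infinite_dimensional X -> uniformly_convex X -> uniformly_smooth X ->
  infinite_dimensional Y -> uniformly_convex Y -> uniformly_smooth Y ->
  norm_of_inner_product ip ->
  compact_operator T -> trivial_kernel T ->
  compact_operator A -> trivial_kernel A -> dense (range A) ->
  compact_operator B -> trivial_kernel B -> dense (range B) ->
  (T : X -> Y) = B \o A ->
  j_eigenvectors ip (adjoint ip A) hA ->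
  j_eigenvectors ip B hB ->
  let lamA := j_eigenvalue ip (adjoint ip A) hA in
  let xA := j_image ip (adjoint ip A) hA in
  let lamB := j_eigenvalue ip B hB in
  let yB := j_image ip B hB in
  let term x j i := (lamB j * lamA i * xA i x * ip (hA i) (hB j)) *: yB j in
  (forall x, T x = B (A x) /\ iterated_sum (term x) (T x)) /\
  (in_l2 lamA -> in_l2 lamB -> forall x, unconditional_sum (term x) (T x)).
Proof.
move=> Xinf _ _ _ _ _ ipE _ _ cA kA dA cB kB _ TE hAE hBE lamA xA lamB yB term.
have Hinf := infinite_dimensional_orthogonal ip Xinf kA.
pose A' : {linear H -> dual X} := HB.pack (adjoint ip A)
  (GRing.isLinear.Build _ _ _ _ _ (adjoint_is_linear ipE cA)).
have [MA A'M] : exists M, forall v, `|A' v| <= M * `|v| := adjoint_bound ipE cA.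
have kA' : trivial_kernel A' := adjoint_trivial_kernel ipE cA dA.
have hA'E : j_eigenvectors ip A' hA := hAE.
have [MB _ BM] := compact_operator_bound cB.
have hAon := j_eigenvectors_orthonormal ipE Hinf kA' hA'E.
have hBon := j_eigenvectors_orthonormal ipE Hinf kB hBE.
have hAtot v : (forall i, ip v (hA i) = 0) -> v = 0.
  apply: (j_eigenvectors_total Hinf A'M kA' hA'E) => e e0.
  exact: (adjoint_orthonormal_small ipE hAon cA e0).
have hBtot v : (forall i, ip v (hB i) = 0) -> v = 0.
  apply: (j_eigenvectors_total Hinf BM kB hBE) => e e0.
  exact: (compact_operator_orthonormal_small ipE hBon cB e0).
have lamA0 : forall i, 0 < lamA i := j_eigenvalue_gt0 Hinf kA' hA'E.
have lamB0 : forall i, 0 < lamB i := j_eigenvalue_gt0 Hinf kB hBE.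
have termE x : term x = fun j i =>
    (ip (A x) (hA i) * ip (hA i) (hB j)) *: B (hB j).
  apply/funext => j; apply/funext => i; rewrite /term.
  have -> : ip (A x) (hA i) = lamA i * xA i x.
    rewrite -(adjointE _ _ ipE cA).
    by have /(congr1 (fun f : dual X => f x)) := j_imageK Hinf kA' hA'E i => <-.
  rewrite -(j_imageK Hinf kB hBE) [RHS]scalerA; congr (_ *: _).
  by rewrite -/lamB; ring.
have sumT x : iterated_sum (term x) (T x).
  rewrite termE TE; apply: iterated_sum_expansion => //.
  - exact: compact_operator_continuous.
  - exact: fourier_expansion.
  - exact: fourier_expansion.
split=> [x|lA lB x]; first by split; [rewrite TE|exact: sumT].
have wA := j_eigenvectors_weighted_bound ipE Hinf A'M kA' hA'E.
have wB := j_eigenvectors_weighted_bound ipE Hinf BM kB hBE.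
have coefA := adjoint_weighted_coef_bound x ipE cA wA.
pose u j i := ip (hA i) (hB j).
have ucol i n : \sum_(0 <= j < n) u j i ^+ 2 <= 1.
  have := bessel ipE hBon (hA i) (iota_uniq 0 n).
  by rewrite -ipE hAon eqxx /index_iota subn0.
have urow j n : \sum_(0 <= i < n) u j i ^+ 2 <= 1.
  have := bessel ipE hAon (hB j) (iota_uniq 0 n).
  rewrite -ipE hBon eqxx /index_iota subn0; congr (_ <= _).
  by apply: eq_bigr => i _; rewrite ipC.
have [K uK] := double_sum_bound lA lB ucol urow.
have wBz c n : `|\sum_(0 <= j < n) (c j / Num.sqrt (lamB j)) *: B (hB j)| ^+ 2 <=
    4 * lamB 0 * \sum_(0 <= j < n) c j ^+ 2.
  have := wB c n; rewrite (linear_sum B).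
  by under eq_bigr do rewrite linearZ.
pose K0 := 4 * lamA 0 * `|x| ^+ 2 * (4 * lamB 0).
have K00 : 0 <= K0.
  by rewrite /K0 !mulr_ge0// ltW.
pose t p := (ip (A x) (hA p.2) * u p.1 p.2) *: B (hB p.1).
rewrite termE; apply: (@square_dominated_unconditional_sum _ _ t
  (fun p => K0 * (lamA p.2 * lamB p.1 * u p.1 p.2 ^+ 2)) (K0 * K)).
- by move=> r ur; rewrite -mulr_sumr ler_wpM2l// uK.
- by move=> r ur; exact: (weighted_family_bound lamA0 lamB0 coefA wBz u ur).
- by have := sumT x; rewrite termE.
Qed.
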